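(* Let $\Gamma$ be a split-by-nilpotent extension of $\Lambda$ by the two-sided ideal $I$ of $\Gamma$, and let $G={}_\Gamma\Gamma_\Lambda\otimes_\Lambda-:\mathrm{mod}(\Lambda)\to\mathrm{mod}(\Gamma)$. For any $M\in\mathrm{mod}(\Lambda)$, the algebra $\mathrm{End}_\Gamma(G(M))$ is a split-by-nilpotent extension of $\mathrm{End}_\Lambda(M)$ by $\mathrm{Hom}_\Lambda(M,I\otimes_\Lambda M)$.
   Context: Algebra means artin algebra over a commutative artinian ring $R$; $\mathrm{mod}(\Lambda)$ is the category of finitely generated left $\Lambda$-modules. Given algebras $\Gamma,\Lambda$ and a two-sided ideal $I$ of $\Gamma$, $\Gamma$ is a split-by-nilpotent extension of $\Lambda$ by $I$ if $I\subseteq\mathrm{rad}(\Gamma)$ and there is an exact sequence of abelian groups $0\to I\to\Gamma\xrightarrow{\pi}\Lambda\to 0$ such that $\pi$ is an epimorphism of algebras and there is a morphism of algebras $\sigma:\Lambda\to\Gamma$ with $\pi\sigma=1_\Lambda$. Through $\sigma$ the objects $\Gamma$ and $I$ are $\Lambda$-$\Lambda$-bimodules, and ${}_\Lambda\Gamma_\Lambda={}_\Lambda\Lambda_\Lambda\oplus{}_\Lambda I_\Lambda$, so $\Gamma\otimes_\Lambda M=(\Lambda\otimes_\Lambda M)\oplus(I\otimes_\Lambda M)$ as $\Lambda$-modules. The $R$-module $\mathrm{Hom}_\Lambda(M,I\otimes_\Lambda M)$ is regarded inside $\mathrm{End}_\Gamma(G(M))$ via the monomorphism $L$ given by $L(g)(\gamma\otimes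 m)=\gamma g(m)$ for $\gamma\in\Gamma$, $m\in M$. *)

(* Defs.v *)
From HB Require Import structures.
From mathcomp Require Import all_boot ssralg ssrint ring_quotient.
From mathcomp Require Import boolp classical_sets.
From mathcomp Require Import freeg.

Set Implicit Arguments.
Unset Strict Implicit.
Unset Printing Implicit Defensive.

Import GRing.Theory.
Local Open Scope ring_scope.
Local Open Scope quotient_scope.
Local Open Scope classical_set_scope.

(* MathComp's algType excludes the zero ring, but the endomorphism algebra of *)
(* the zero module is the zero algebra. Here an R-algebra is a possibly zero  *)
(* ring A with a ring morphism from R to the center of A.                     *)
HB.mixin Record PzRing_isPzAlgebra (R : comPzRingType) A of GRing.PzRing A := {
  algmap : {rmorphism R -> A};
  algmapC : forall (r : R) (a : A), algmap r * a = a * algmap r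
}.

#[short(type="pzAlgType")]
HB.structure Definition PzAlgebra (R : comPzRingType) :=
  {A of GRing.PzRing A & PzRing_isPzAlgebra R A}.

HB.mixin Record isPzAlgHom (R : comPzRingType) (A B : pzAlgType R) (f : A -> B) := {
  alghom_algmap : forall r : R, f (algmap r) = algmap r
}.

#[short(type="pzAlgHom")]
HB.structure Definition PzAlgHom (R : comPzRingType) (A B : pzAlgType R) :=
  {f of @GRing.RMorphism A B f & isPzAlgHom R A B f}.

Section RestrictedModule.
Variables (R : comPzRingType) (A : pzAlgType R).

(* An A-module regarded as an R-module. *)
Definition restricted (V : lmodType A) : Type := V.

Variable V : lmodType A.
HB.instance Definition _ := GRing.Zmodule.on (restricted V).

Definition rscale (r : R) (v : restricted V) : restricted V :=
  (algmap r : A) *: (v : V).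

Fact rscaleA r s v : rscale r (rscale s v) = rscale (r * s) v.
Proof. by rewrite /rscale scalerA rmorphM. Qed.
Fact rscale1 : left_id 1 rscale.
Proof. by move=> v; rewrite /rscale rmorph1 scale1r. Qed.
Fact rscaleDr : right_distributive rscale +%R.
Proof. by move=> r u v; apply: scalerDr. Qed.
Fact rscaleDl v : {morph rscale^~ v : r s / r + s}.
Proof. by move=> r s; rewrite /rscale rmorphD scalerDl. Qed.

HB.instance Definition _ := GRing.Zmodule_isLmodule.Build R (restricted V)
  rscaleA rscale1 rscaleDr rscaleDl.

End RestrictedModule.

Section RingNotions.
Variable A : pzRingType.

Definition left_ideal (I : set A) :=
  [/\ I 0, (forall x y, I x -> I y -> I (x + y)) &
      forall a x, I x -> I (a * x)].

Definition two_sided_ideal (I : set A) :=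
  left_ideal I /\ forall x a, I x -> I (x * a).

Definition maximal_left_ideal (I : set A) :=
  [/\ left_ideal I, I <> [set: A] &
      forall J, left_ideal J -> I `<=` J -> J = I \/ J = [set: A]].

Definition jacobson_radical : set A :=
  [set x | forall I, maximal_left_ideal I -> I x].

Definition artinian :=
  forall I : nat -> set A,
    (forall n, left_ideal (I n)) -> (forall n, I n.+1 `<=` I n) ->
    exists N, forall n, (N <= n)%N -> I n = I N.

Definition finitely_generated (V : lmodType A) :=
  exists (n : nat) (e : 'I_n -> V),
    forall v, exists c : 'I_n -> A, v = \sum_i c i *: e i.

Record twoSidedIdeal := TwoSidedIdeal {
  ideal_set :> set A;
  ideal_two_sided : two_sided_ideal ideal_set
}.

End RingNotions.

Arguments jacobson_radical : clear implicits.
Arguments artinian : clear implicits.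

Section SplitByNilpotent.
Variables (R : comPzRingType) (Gam Lam : pzAlgType R).

Definition artin_algebra (A : pzAlgType R) :=
  artinian R /\ finitely_generated (restricted A^o).

Definition split_by_nilpotent_data (I : set Gam)
    (pi : pzAlgHom Gam Lam) (sigma : pzAlgHom Lam Gam) :=
  [/\ artin_algebra Gam /\ artin_algebra Lam,
      two_sided_ideal I,
      I `<=` jacobson_radical Gam,
      (forall l, exists g, pi g = l) /\ (forall g, pi g = 0 <-> I g) &
      forall l, pi (sigma l) = l].

Definition split_by_nilpotent_extension (I : set Gam) :=
  exists pi sigma, split_by_nilpotent_data I pi sigma.

End SplitByNilpotent.

Arguments split_by_nilpotent_extension {R} Gam Lam I.

Section LinearMaps.
Variables (R : comPzRingType) (A : pzAlgType R).
Variables (M N : lmodType A).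

Definition homs := {linear M -> N}.

HB.instance Definition _ := gen_eqMixin homs.
HB.instance Definition _ := gen_choiceMixin homs.

Lemma homsP (f g : homs) : (forall x, f x = g x) -> f = g.
Proof.
case: f g => f [fA fZ] [g [gA gZ]] /= /funext efg.
rewrite -{}efg in gA gZ *; case: fA gA fZ gZ => [fD0] [gD0] [fZ] [gZ].
by rewrite (Prop_irrelevance fD0 gD0) (Prop_irrelevance fZ gZ).
Qed.

Fact hom_zero_linear : linear ((fun _ => 0) : M -> N).
Proof. by move=> a x y; rewrite scaler0 addr0. Qed.
Fact hom_opp_linear (f : homs) : linear (fun x => - f x).
Proof. by move=> a x y; rewrite linearP opprD scalerN. Qed.
Fact hom_add_linear (f g : homs) : linear (fun x => f x + g x).
Proof. by move=> a x y; rewrite !linearP scalerDr addrACA. Qed.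
Fact hom_scale_linear (r : R) (f : homs) : linear (fun x => (algmap r : A) *: f x).
Proof. by move=> a x y; rewrite linearP scalerDr !scalerA algmapC. Qed.

Definition mk_hom (f : M -> N) (lf : linear f) : homs :=
  HB.pack f (GRing.isLinear.Build A M N *:%R f lf).

Definition hom_zero := mk_hom hom_zero_linear.
Definition hom_opp f := mk_hom (hom_opp_linear f).
Definition hom_add f g := mk_hom (hom_add_linear f g).
Definition hom_scale r f := mk_hom (hom_scale_linear r f).

Fact hom_addA : associative hom_add.
Proof. by move=> f g h; apply: homsP => x; apply: addrA. Qed.
Fact hom_addC : commutative hom_add.
Proof. by move=> f g; apply: homsP => x; apply: addrC. Qed.
Fact hom_add0 : left_id hom_zero hom_add.
Proof. by move=> f; apply: homsP => x; apply: add0r. Qed.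
Fact hom_addN : left_inverse hom_zero hom_opp hom_add.
Proof. by move=> f; apply: homsP => x; apply: addNr. Qed.

HB.instance Definition _ :=
  GRing.isZmodule.Build homs hom_addA hom_addC hom_add0 hom_addN.

Fact hom_scaleA r s f : hom_scale r (hom_scale s f) = hom_scale (r * s) f.
Proof. by apply: homsP => x /=; rewrite rmorphM scalerA. Qed.
Fact hom_scale1 : left_id 1 hom_scale.
Proof. by move=> f; apply: homsP => x /=; rewrite rmorph1 scale1r. Qed.
Fact hom_scaleDr : right_distributive hom_scale +%R.
Proof. by move=> r f g; apply: homsP => x; apply: scalerDr. Qed.
Fact hom_scaleDl f : {morph hom_scale^~ f : r s / r + s}.
Proof. by move=> r s; apply: homsP => x /=; rewrite rmorphD scalerDl. Qed.

HB.instance Definition _ := GRing.Zmodule_isLmodule.Build R homs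
  hom_scaleA hom_scale1 hom_scaleDr hom_scaleDl.

Lemma homs_addE (f g : homs) x : (f + g) x = f x + g x. Proof. by []. Qed.
Lemma homs_scaleE r (f : homs) x : (r *: f) x = (algmap r : A) *: f x.
Proof. by []. Qed.

End LinearMaps.

Section Endomorphisms.
Variables (R : comPzRingType) (A : pzAlgType R) (M : lmodType A).

Definition endo := homs M M.

HB.instance Definition _ := GRing.Zmodule.on endo.

(* The product of endomorphisms is composition, (f * g) x = f (g x).          *)
Fact endo_one_linear : linear (fun x : M => x). Proof. by []. Qed.
Fact endo_mul_linear (f g : endo) : linear (fun x => f (g x)).
Proof. by move=> a x y; rewrite !linearP. Qed.

Definition endo_one : endo := mk_hom endo_one_linear.
Definition endo_mul (f g : endo) : endo := mk_hom (endo_mul_linear f g).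

Fact endo_mulA : associative endo_mul.
Proof. by move=> f g h; apply: homsP. Qed.
Fact endo_mul1l : left_id endo_one endo_mul.
Proof. by move=> f; apply: homsP. Qed.
Fact endo_mul1r : right_id endo_one endo_mul.
Proof. by move=> f; apply: homsP. Qed.
Fact endo_mulDl : left_distributive endo_mul +%R.
Proof. by move=> f g h; apply: homsP. Qed.
Fact endo_mulDr : right_distributive endo_mul +%R.
Proof. by move=> f g h; apply: homsP => x; apply: linearD. Qed.

HB.instance Definition _ := GRing.Zmodule_isPzRing.Build endo
  endo_mulA endo_mul1l endo_mul1r endo_mulDl endo_mulDr.

Definition endo_algmap (r : R) : endo := hom_scale r endo_one.

Fact endo_algmap_zmod : zmod_morphism endo_algmap.
Proof. by move=> r s; apply: homsP => x /=; rewrite rmorphB scalerBl. Qed.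
Fact endo_algmap_monoid : monoid_morphism endo_algmap.
Proof.
split=> [|r s]; apply: homsP => x /=; first by rewrite rmorph1 scale1r.
by rewrite rmorphM scalerA.
Qed.
HB.instance Definition _ :=
  GRing.isZmodMorphism.Build R endo endo_algmap endo_algmap_zmod.
HB.instance Definition _ :=
  GRing.isMonoidMorphism.Build R endo endo_algmap endo_algmap_monoid.

Fact endo_algmapC (r : R) (f : endo) : endo_algmap r * f = f * endo_algmap r.
Proof. by apply: homsP => x /=; rewrite linearZ. Qed.

HB.instance Definition _ := PzRing_isPzAlgebra.Build R endo endo_algmapC.

End Endomorphisms.

HB.mixin Record Lmodule_isBimodule (A B : pzRingType) X of GRing.Lmodule A X := {
  ract : X -> B -> X;
  ractA : forall x b c, ract (ract x b) c = ract x (b * c);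
  ract1 : forall x, ract x 1 = x;
  ractDl : forall x y b, ract (x + y) b = ract x b + ract y b;
  ractDr : forall x b c, ract x (b + c) = ract x b + ract x c;
  ractZ : forall (a : A) x b, ract (a *: x) b = a *: ract x b
}.

#[short(type="bimodType")]
HB.structure Definition Bimodule (A B : pzRingType) :=
  {X of GRing.Lmodule A X & Lmodule_isBimodule A B X}.

Section Tensor.
Variables (A B : pzRingType) (X : bimodType A B) (M : lmodType B).

Local Notation free := {freeg (X * M)%type / int}.
Local Notation gen x m := (<< (x, m) >> : free).

Inductive tensor_relator : free -> Prop :=
| RelDl x y m : tensor_relator (gen (x + y) m - (gen x m + gen y m))
| RelDr x m n : tensor_relator (gen x (m + n) - (gen x m + gen x n))
| RelA x b m : tensor_relator (gen (ract x b) m - gen x (b *: m)).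

(* The subgroup generated by the relators. *)
Definition tensor_relations : {pred free} :=
  fun u => `[< forall S : zmodClosed free,
                 (forall r, tensor_relator r -> r \in S) -> u \in S >].

Fact tensor_relations_closed : zmod_closed tensor_relations.
Proof.
split=> [|u v /asboolP uS /asboolP vS]; apply/asboolP => S relS.
  exact: rpred0.
by rewrite rpredB ?uS ?vS.
Qed.
HB.instance Definition _ :=
  GRing.isZmodClosed.Build free tensor_relations tensor_relations_closed.

Definition tensor : Type := {ideal_quot tensor_relations}.
HB.instance Definition _ := GRing.Zmodule.on tensor.

Definition tens (x : X) (m : M) : tensor :=
  \pi_{ideal_quot tensor_relations} (gen x m).

Fact pi_zmod_morphism :
  zmod_morphism (\pi_{ideal_quot tensor_relations} : free -> tensor).
Proof. by move=> u v /=; rewrite !piE. Qed.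

Lemma pi_relator (u : free) :
  tensor_relator u -> \pi_{ideal_quot tensor_relations} u = 0 :> tensor.
Proof.
move=> ru; have -> : (0 : tensor) = \pi_{ideal_quot tensor_relations} 0.
  by rewrite !piE.
apply/eqP; rewrite -Quotient.idealrBE subr0; apply/asboolP => S; exact.
Qed.

Lemma tensDl x y m : tens (x + y) m = tens x m + tens y m.
Proof.
apply/eqP; rewrite -subr_eq0 /tens; apply/eqP.
by rewrite -(pi_relator (RelDl x y m)) !piE.
Qed.

Lemma tensDr x m n : tens x (m + n) = tens x m + tens x n.
Proof.
apply/eqP; rewrite -subr_eq0 /tens; apply/eqP.
by rewrite -(pi_relator (RelDr x m n)) !piE.
Qed.

Lemma tensA x b m : tens (ract x b) m = tens x (b *: m).
Proof.
apply/eqP; rewrite -subr_eq0 /tens; apply/eqP.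
by rewrite -(pi_relator (RelA x b m)) !piE.
Qed.

Lemma tens_ind (P : tensor -> Prop) :
  P 0 -> (forall s t, P s -> P t -> P (s - t)) -> (forall x m, P (tens x m)) ->
  forall t, P t.
Proof.
move=> P0 PB Pt.
have PN s : P s -> P (- s) by move=> Ps; rewrite -sub0r; apply: PB.
have PD s t : P s -> P t -> P (s + t).
  by move=> Ps Pu; rewrite -[t]opprK; apply: PB => //; apply: PN.
have piD (u v : free) : \pi_{ideal_quot tensor_relations} (u + v) =
    \pi_{ideal_quot tensor_relations} u + \pi_{ideal_quot tensor_relations} v
    :> tensor by rewrite !piE.
have pi0 : \pi_{ideal_quot tensor_relations} 0 = 0 :> tensor.
  by have := pi_zmod_morphism 0 0; rewrite !subrr.
have Pn (n : nat) x m : P (\pi_{ideal_quot tensor_relations} (gen x m *+ n)).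
  elim: n => [|n IHn]; first by rewrite mulr0n pi0.
  by rewrite mulrSr piD; apply: PD IHn (Pt x m).
suff Ppi (u : free) : P (\pi_{ideal_quot tensor_relations} u).
  by move=> t; rewrite -[t](reprK (qT := {ideal_quot tensor_relations})).
move: u; apply: freeg_ind_dom0 => [|k [x m] u _ _ IHu]; first by rewrite pi0.
rewrite piD; apply: PD IHu; rewrite -[k]intz -freegU_mulz.
case: k => n; first exact: Pn.
rewrite NegzE mulrNz.
have -> : \pi_{ideal_quot tensor_relations} (- (gen x m *~ n.+1)) =
    - \pi_{ideal_quot tensor_relations} (gen x m *~ n.+1) :> tensor.
  by rewrite !piE.
exact/PN/Pn.
Qed.

Section Lift.
Variable V : zmodType.

Definition balanced (f : X -> M -> V) :=
  [/\ forall x y m, f (x + y) m = f x m + f y m,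
      forall x m n, f x (m + n) = f x m + f x n &
      forall x b m, f (ract x b) m = f x (b *: m)].

(* The additive map sending tens x m to f x m; junk unless f is balanced. *)
Definition tens_lift (f : X -> M -> V) (t : tensor) : V :=
  fglift (fun p => f p.1 p.2 : zmodule V) (repr t).

Variables (f : X -> M -> V) (bf : balanced f).

Let phi (u : free) : V := fglift (fun p => f p.1 p.2 : zmodule V) u.

Let phiB : zmod_morphism phi.
Proof.
exact: (@lift_is_additive int (X * M)%type (zmodule V) (fun p => f p.1 p.2)).
Qed.

Let phi_gen x m : phi (gen x m) = f x m.
Proof. by rewrite /phi liftU scale1r. Qed.

Let ker_phi : {pred free} := fun u => phi u == 0.

Let ker_phi_closed : zmod_closed ker_phi.
Proof.
rewrite /ker_phi; split=> [|u v /eqP u0 /eqP v0]; apply/eqP.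
  by rewrite -[0]subr0 phiB subrr.
by rewrite phiB u0 v0 subr0.
Qed.

Let phi_pi u : tens_lift f (\pi_{ideal_quot tensor_relations} u) = phi u.
Proof.
pose S : zmodClosed free :=
  HB.pack ker_phi (GRing.isZmodClosed.Build free ker_phi ker_phi_closed).
rewrite /tens_lift -/(phi _).
set v := repr _; have : v - u \in tensor_relations.
  by rewrite Quotient.idealrBE /v reprK.
move=> /asboolP/(_ S) H; apply/eqP; rewrite -subr_eq0 -phiB.
have [fDl fDr fA] := bf.
apply: H => r [x y m|x m n|x b m]; apply/eqP; rewrite phiB.
- have -> : gen x m + gen y m = gen x m - (0 - gen y m) by rewrite sub0r opprK.
  by rewrite !phiB !phi_gen -[0 in X in _ - (_ - X)]subr0
    phiB subrr sub0r opprK fDl subrr.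
- have -> : gen x m + gen x n = gen x m - (0 - gen x n) by rewrite sub0r opprK.
  by rewrite !phiB !phi_gen -[0 in X in _ - (_ - X)]subr0
    phiB subrr sub0r opprK fDr subrr.
- by rewrite !phi_gen fA subrr.
Qed.

Lemma tens_liftE x m : tens_lift f (tens x m) = f x m.
Proof. by rewrite /tens phi_pi phi_gen. Qed.

Lemma tens_lift_zmod : zmod_morphism (tens_lift f).
Proof.
elim/quotW=> u; elim/quotW=> v.
have -> : \pi_{ideal_quot tensor_relations} u -
    \pi_{ideal_quot tensor_relations} v =
    \pi_{ideal_quot tensor_relations} (u - v) :> tensor by rewrite !piE.
by rewrite !phi_pi phiB.
Qed.

End Lift.

Lemma tens_ext (V : zmodType) (f g : tensor -> V) :
  zmod_morphism f -> zmod_morphism g ->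
  (forall x m, f (tens x m) = g (tens x m)) -> f =1 g.
Proof.
move=> fB gB fg; elim/tens_ind => [|s t IHs IHt|//].
  by rewrite -[0]subr0 fB gB !subrr.
by rewrite fB gB IHs IHt.
Qed.

Definition tens_scale (a : A) : tensor -> tensor :=
  tens_lift (fun x m => tens (a *: x) m).

Fact tens_scale_balanced (a : A) : balanced (fun x m => tens (a *: x) m).
Proof.
split=> [x y m|x m n|x b m]; first by rewrite scalerDr tensDl.
  by rewrite tensDr.
by rewrite -ractZ tensA.
Qed.

Lemma tens_scaleE a x m : tens_scale a (tens x m) = tens (a *: x) m.
Proof. exact/tens_liftE/tens_scale_balanced. Qed.

Fact tens_scaleB a : zmod_morphism (tens_scale a).
Proof. exact/tens_lift_zmod/tens_scale_balanced. Qed.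

Fact tens_scaleA a b t : tens_scale a (tens_scale b t) = tens_scale (a * b) t.
Proof.
move: t; apply: tens_ext => [s t|s t|x m]; rewrite ?tens_scaleB //.
by rewrite !tens_scaleE scalerA.
Qed.
Fact tens_scale1 : left_id 1 tens_scale.
Proof.
by apply: tens_ext => [s t|s t|x m]; rewrite ?tens_scaleB ?tens_scaleE ?scale1r.
Qed.
Fact tens_scaleDr : right_distributive tens_scale +%R.
Proof.
move=> a s t; rewrite -[t in LHS]opprK tens_scaleB -[- t]sub0r tens_scaleB.
by rewrite -[0]subr0 tens_scaleB subrr sub0r opprK.
Qed.
Fact tens_scaleDl t : {morph tens_scale^~ t : a b / a + b}.
Proof.
move=> a b /=; move: t.
apply: (tens_ext (g := fun t => tens_scale a t + tens_scale b t)) => [s t|s t|x m].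
- by rewrite tens_scaleB.
- by rewrite !tens_scaleB opprD addrACA.
- by rewrite !tens_scaleE scalerDl tensDl.
Qed.

HB.instance Definition _ := GRing.Zmodule_isLmodule.Build A tensor
  tens_scaleA tens_scale1 tens_scaleDr tens_scaleDl.

Lemma tensZ a x m : a *: tens x m = tens (a *: x) m.
Proof. exact: tens_scaleE. Qed.

End Tensor.

Arguments tens {A B X M} x m.

Section BimodulesOfExtension.
Variables (R : comPzRingType) (Gam Lam : pzAlgType R).

(* Gam as a Gam-Lam-bimodule, Lam acting on the right through sigma. *)
Definition ext_bimod (sigma : pzAlgHom Lam Gam) : Type := Gam.

(* The ideal I as a Lam-Lam-bimodule through sigma. *)
Record ideal_elt (I : twoSidedIdeal Gam) := IdealElt {
  ideal_val : Gam;
  ideal_valP : ideal_val \in (I : set Gam)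
}.
Definition ideal_bimod (sigma : pzAlgHom Lam Gam) (I : twoSidedIdeal Gam) :=
  ideal_elt I.

Variables (sigma : pzAlgHom Lam Gam) (I : twoSidedIdeal Gam).

HB.instance Definition _ := GRing.Zmodule.on (ext_bimod sigma).

Definition ext_scale (g : Gam) (x : ext_bimod sigma) : ext_bimod sigma :=
  g * (x : Gam).
Definition ext_ract (x : ext_bimod sigma) (l : Lam) : ext_bimod sigma :=
  (x : Gam) * sigma l.

Fact ext_scaleA g h x : ext_scale g (ext_scale h x) = ext_scale (g * h) x.
Proof. exact: mulrA. Qed.
Fact ext_scale1 : left_id 1 ext_scale.
Proof. by move=> x; apply: mul1r. Qed.
Fact ext_scaleDr : right_distributive ext_scale +%R.
Proof. by move=> g x y; apply: mulrDr. Qed.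
Fact ext_scaleDl x : {morph ext_scale^~ x : g h / g + h}.
Proof. by move=> g h; apply: mulrDl. Qed.
HB.instance Definition _ := GRing.Zmodule_isLmodule.Build Gam (ext_bimod sigma)
  ext_scaleA ext_scale1 ext_scaleDr ext_scaleDl.

Fact ext_ractA x b c : ext_ract (ext_ract x b) c = ext_ract x (b * c).
Proof. by rewrite /ext_ract rmorphM mulrA. Qed.
Fact ext_ract1 x : ext_ract x 1 = x.
Proof. by rewrite /ext_ract rmorph1 mulr1. Qed.
Fact ext_ractDl x y b : ext_ract (x + y) b = ext_ract x b + ext_ract y b.
Proof. exact: mulrDl. Qed.
Fact ext_ractDr x b c : ext_ract x (b + c) = ext_ract x b + ext_ract x c.
Proof. by rewrite /ext_ract rmorphD; apply: mulrDr. Qed.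
Fact ext_ractZ (g : Gam) x b : ext_ract (g *: x) b = g *: ext_ract x b.
Proof. by apply/esym; apply: mulrA. Qed.
HB.instance Definition _ := Lmodule_isBimodule.Build Gam Lam (ext_bimod sigma)
  ext_ractA ext_ract1 ext_ractDl ext_ractDr ext_ractZ.

HB.instance Definition _ := [isSub of ideal_elt I for @ideal_val I].
HB.instance Definition _ := [Choice of ideal_elt I by <:].

Fact ideal_zmod_closed : zmod_closed (fun x : Gam => x \in (I : set Gam)).
Proof.
have [[I0 ID IM] _] := ideal_two_sided I.
split=> [|x y]; rewrite ?inE // => Ix Iy.
by rewrite -[y]mul1r -mulNr; apply/ID/IM.
Qed.
HB.instance Definition _ :=
  GRing.SubChoice_isSubZmodule.Build Gam _ (ideal_elt I) ideal_zmod_closed.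
HB.instance Definition _ := GRing.Zmodule.on (ideal_bimod sigma I).

Fact ideal_scale_subproof (l : Lam) (x : ideal_bimod sigma I) :
  sigma l * ideal_val x \in (I : set Gam).
Proof.
case: x => x /=; rewrite !inE => Ix.
by have [[_ _ IM] _] := ideal_two_sided I; apply: IM.
Qed.
Fact ideal_ract_subproof (x : ideal_bimod sigma I) (l : Lam) :
  ideal_val x * sigma l \in (I : set Gam).
Proof.
case: x => x /=; rewrite !inE => Ix.
by have [_ IM] := ideal_two_sided I; apply: IM.
Qed.
Definition ideal_scale l x : ideal_bimod sigma I :=
  IdealElt (ideal_scale_subproof l x).
Definition ideal_ract x l : ideal_bimod sigma I :=
  IdealElt (ideal_ract_subproof x l).

Fact ideal_scaleA k l x : ideal_scale k (ideal_scale l x) = ideal_scale (k * l) x.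
Proof. by apply: val_inj; rewrite /= rmorphM mulrA. Qed.
Fact ideal_scale1 : left_id 1 ideal_scale.
Proof. by move=> x; apply: val_inj; rewrite /= rmorph1 mul1r. Qed.
Fact ideal_scaleDr : right_distributive ideal_scale +%R.
Proof. by move=> l x y; apply: val_inj; rewrite /= mulrDr. Qed.
Fact ideal_scaleDl x : {morph ideal_scale^~ x : k l / k + l}.
Proof. by move=> k l; apply: val_inj; rewrite /= rmorphD mulrDl. Qed.
HB.instance Definition _ :=
  GRing.Zmodule_isLmodule.Build Lam (ideal_bimod sigma I)
    ideal_scaleA ideal_scale1 ideal_scaleDr ideal_scaleDl.

Fact ideal_ractA x b c : ideal_ract (ideal_ract x b) c = ideal_ract x (b * c).
Proof. by apply: val_inj; rewrite /= rmorphM mulrA. Qed.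
Fact ideal_ract1 x : ideal_ract x 1 = x.
Proof. by apply: val_inj; rewrite /= rmorph1 mulr1. Qed.
Fact ideal_ractDl x y b : ideal_ract (x + y) b = ideal_ract x b + ideal_ract y b.
Proof. by apply: val_inj; rewrite /= mulrDl. Qed.
Fact ideal_ractDr x b c : ideal_ract x (b + c) = ideal_ract x b + ideal_ract x c.
Proof. by apply: val_inj; rewrite /= rmorphD mulrDr. Qed.
Fact ideal_ractZ (l : Lam) x b : ideal_ract (l *: x) b = l *: ideal_ract x b.
Proof. by apply: val_inj; rewrite /= mulrA. Qed.
HB.instance Definition _ :=
  Lmodule_isBimodule.Build Lam Lam (ideal_bimod sigma I)
    ideal_ractA ideal_ract1 ideal_ractDl ideal_ractDr ideal_ractZ.

Variable M : lmodType Lam.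

Definition induced_module : lmodType Gam := tensor (ext_bimod sigma) M.
Definition ideal_tensor : lmodType Lam := tensor (ideal_bimod sigma I) M.

(* The map I (x) M -> Gam (x) M induced by the inclusion of I into Gam. *)
Definition ideal_incl : ideal_tensor -> induced_module :=
  tens_lift (fun (x : ideal_bimod sigma I) m =>
    tens (ideal_val x : ext_bimod sigma) m).

Fact ideal_incl_balanced :
  balanced (fun (x : ideal_bimod sigma I) m =>
    tens (ideal_val x : ext_bimod sigma) m : induced_module).
Proof.
split=> [x y m|x m n|x b m]; [exact: tensDl|exact: tensDr|].
exact: (tensA (ideal_val x : ext_bimod sigma)).
Qed.

Lemma ideal_inclE (x : ideal_bimod sigma I) m :
  ideal_incl (tens x m) = tens (ideal_val x : ext_bimod sigma) m.
Proof. exact/tens_liftE/ideal_incl_balanced. Qed.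

Fact ideal_incl_zmod : zmod_morphism ideal_incl.
Proof. exact/tens_lift_zmod/ideal_incl_balanced. Qed.
HB.instance Definition _ :=
  GRing.isZmodMorphism.Build ideal_tensor induced_module ideal_incl ideal_incl_zmod.

Lemma ideal_incl_scale (l : Lam) t : ideal_incl (l *: t) = sigma l *: ideal_incl t.
Proof.
move: t; apply: tens_ext => [s t|s t|x m].
- by rewrite scalerBr raddfB.
- by rewrite raddfB scalerBr.
- by rewrite tensZ !ideal_inclE tensZ.
Qed.

(* The map gamma (x) m |-> gamma h(m); the value h(m) of I (x) M is read in    *)
(* Gam (x) M through ideal_incl. Its defining equation is hom_embeddingE.     *)
Definition hom_embedding_fun (h : homs M ideal_tensor) :
    induced_module -> induced_module :=
  tens_lift (fun (g : ext_bimod sigma) m => (g : Gam) *: ideal_incl (h m)).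

Fact hom_embedding_balanced (h : homs M ideal_tensor) :
  balanced (fun (g : ext_bimod sigma) m => (g : Gam) *: ideal_incl (h m)).
Proof.
split=> [x y m|x m n|x b m]; first exact: scalerDl.
  by rewrite !raddfD.
by rewrite linearZ /= ideal_incl_scale scalerA.
Qed.

Fact hom_embedding_linear (h : homs M ideal_tensor) : linear (hom_embedding_fun h).
Proof.
have LB : zmod_morphism (hom_embedding_fun h) :=
  tens_lift_zmod (hom_embedding_balanced h).
move=> a u v; rewrite -[v in LHS]opprK LB -[- v]sub0r LB.
rewrite -[0]subr0 LB subrr sub0r opprK; congr (_ + _).
move: u; apply: tens_ext => [s t|s t|x m].
- by rewrite scalerBr LB.
- by rewrite LB scalerBr.
- by rewrite tensZ /hom_embedding_fun !tens_liftE;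
    [rewrite scalerA|exact: hom_embedding_balanced..].
Qed.

Definition hom_embedding (h : homs M ideal_tensor) : endo induced_module :=
  mk_hom (hom_embedding_linear h).

Lemma hom_embeddingE (h : homs M ideal_tensor) (g : ext_bimod sigma) m :
  hom_embedding h (tens g m) = (g : Gam) *: ideal_incl (h m).
Proof. exact/tens_liftE/hom_embedding_balanced. Qed.

Fact hom_embedding_R_linear :
  linear (hom_embedding : homs M ideal_tensor -> homs induced_module induced_module).
Proof.
move=> r h k; apply: homsP; apply: tens_ext => [s t|s t|g m].
- exact: raddfB.
- exact: raddfB.
rewrite homs_addE homs_scaleE !hom_embeddingE homs_addE homs_scaleE raddfD scalerDr.
rewrite /= ideal_incl_scale alghom_algmap; congr (_ + _).
by rewrite !scalerA algmapC.
Qed.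
HB.instance Definition _ := GRing.isLinear.Build R (homs M ideal_tensor)
  (homs induced_module induced_module) *:%R hom_embedding hom_embedding_R_linear.

End BimodulesOfExtension.

Arguments hom_embedding {R Gam Lam} sigma I M h.

(* Main.v *)
(* Write p for the map Gam (x) M -> M, g (x) m |-> pi(g) m, whose kernel is   *)
(* the image of I (x) M. Then f |-> (m |-> p (f (1 (x) m))) is an algebra     *)
(* morphism End(G M) -> End(M), split by f |-> 1 (x) f, with kernel the range *)
(* of L. If f lies in that range, then f maps G M into I (G M), so 1 - f is   *)
(* onto by Nakayama; as G M is noetherian over R, 1 - f is also injective.    *)
(* Applied to all multiples of f, this puts f in the radical. Finite          *)
(* generation of the endomorphism algebras over R holds because an artinian   *)
(* commutative ring is noetherian.                                            *)

From HB Require Import structures.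
Require Import Defs.
From mathcomp Require Import all_boot ssralg.
From mathcomp Require Import boolp classical_sets.

Set Implicit Arguments.
Unset Strict Implicit.
Unset Printing Implicit Defensive.

Import GRing.Theory.
Local Open Scope ring_scope.
Local Open Scope classical_set_scope.

(** The algebraic half rests on the splitting of G(M) over Lam into I (x) M and 1 (x) M
    ([induced_decomposition]), which comes from g = (g - sigma (pi g)) + sigma (pi g). It makes
    [ideal_incl], hence L, injective, and it identifies the kernel of the algebra morphism
    [endo_proj] with the range of L ([endo_proj_eq0]); [endo_induced] is a section of [endo_proj].

    The radical half uses that x lies in the radical once every 1 - y x has a left inverse
    ([mem_jacobson_radical]). A left multiple of an element of the range of L is again some L(h),
    and 1 - L(h) is onto by [nakayama], since L(h) maps G(M) into I G(M). A surjective endomorphism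
    of a finitely generated module over an artin algebra is left invertible
    ([surjective_endo_left_invertible]), because such a module is noetherian over R. That finiteness
    comes from [artinian_noetherian], and it also makes the endomorphism algebras artin algebras
    ([artin_algebra_endo]). *)

Definition submodule (A : pzRingType) (V : lmodType A) (W : set V) :=
  [/\ W 0, (forall x y, W x -> W y -> W (x + y)) &
      forall a x, W x -> W (a *: x)].

(** * Submodules, spans and maximal avoiding submodules *)

Section Submodules.
Variables (A : pzRingType) (V : lmodType A).
Implicit Types (W K : set V) (x y : V) (s : seq V).

Lemma submoduleB W x y : submodule W -> W x -> W y -> W (x - y).
Proof. by move=> [_ WD WZ] Wx Wy; rewrite -scaleN1r; apply/WD/WZ. Qed.

Lemma submodule_sum W n (c : 'I_n -> A) (e : 'I_n -> V) :
  submodule W -> (forall i, W (e i)) -> W (\sum_i c i *: e i).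
Proof.
move=> [W0 WD WZ] We; elim/big_ind: _ => [//|x y|i _]; first exact: WD.
exact: WZ.
Qed.

Lemma submoduleI W K : submodule W -> submodule K -> submodule (W `&` K).
Proof.
move=> [W0 WD WZ] [K0 KD KZ]; split=> // [x y [Wx Kx] [Wy Ky]|a x [Wx Kx]].
  by split; [apply: WD|apply: KD].
by split; [apply: WZ|apply: KZ].
Qed.

Lemma submoduleD_line W x :
  submodule W -> submodule [set w + a *: x | w in W & a in [set: A]].
Proof.
move=> [W0 WD WZ]; split.
- by exists 0 => //; exists 0 => //; rewrite scale0r addr0.
- move=> _ _ [w Ww [a _ <-]] [v Wv [b _ <-]].
  exists (w + v); first exact: WD.
  by exists (a + b) => //; rewrite scalerDl addrACA.
- move=> b _ [w Ww [a _ <-]]; exists (b *: w); first exact: WZ.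
  by exists (b * a) => //; rewrite scalerDr scalerA.
Qed.

Definition span s : set V :=
  [set v | forall W, submodule W -> (forall x, x \in s -> W x) -> W v].

Lemma span_submodule s : submodule (span s).
Proof.
split=> [W []//|x y sx sy W Wsub Ws|a x sx W Wsub Ws].
  by have [_ WD _] := Wsub; apply: WD; [exact: (sx W)|exact: (sy W)].
by have [_ _ WZ] := Wsub; apply: WZ; exact: (sx W).
Qed.

Lemma mem_span s x : x \in s -> span s x.
Proof. by move=> sx W _ Ws; apply: Ws. Qed.

Lemma span_min s W :
  submodule W -> (forall x, x \in s -> W x) -> forall v, span s v -> W v.
Proof. by move=> Wsub Ws v sv; apply: sv. Qed.

Lemma span_sub s t : {subset s <= t} -> forall v, span s v -> span t v.
Proof.
move=> st v; apply: span_min => [|x /st]; first exact: span_submodule.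
exact: mem_span.
Qed.

Lemma span_codom n (e : 'I_n -> V) v :
  span (codom e) v <-> exists c : 'I_n -> A, v = \sum_i c i *: e i.
Proof.
split=> [ev|[c ->]]; last first.
  apply: (submodule_sum c (span_submodule _)) => i.
  exact: mem_span (codom_f e i).
pose W := [set v | exists c : 'I_n -> A, v = \sum_i c i *: e i].
apply: (span_min (W := W)) ev.
  split.
  - by exists (fun=> 0); rewrite big1// => i _; rewrite scale0r.
  - move=> _ _ [c ->] [d ->]; exists (fun i => c i + d i).
    by rewrite -big_split; apply: eq_bigr => i _; rewrite scalerDl.
  - move=> a _ [c ->]; exists (fun i => a * c i).
    by rewrite scaler_sumr; apply: eq_bigr => i _; rewrite scalerA.
move=> _ /codomP[i ->]; exists (fun j => (j == i)%:R).
rewrite (bigD1 i)//= eqxx scale1r big1 ?addr0// => j /negPf ->.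
by rewrite scale0r.
Qed.

Definition fg_set W := exists s, W = span s.

Definition noetherian_module := forall W, submodule W -> fg_set W.

Lemma finitely_generatedP : finitely_generated V <-> fg_set setT.
Proof.
split=> [[n [e ge]]|[s sT]].
  exists (codom e); apply/seteqP; split=> // v _; exact/span_codom/ge.
exists (size s), (tnth (in_tuple s)) => v; apply/span_codom.
have : span s v by rewrite -sT.
apply: span_sub => x /(tnthP (in_tuple s))[i ->]; exact: codom_f.
Qed.

(** By Zorn's lemma there is a K maximal among the submodules that contain W and miss x. For y
    outside K the submodule K + A y is strictly larger, so it must contain x; this is the last
    clause. *)
Lemma exists_submodule_avoiding W x :
  submodule W -> ~ W x ->
  exists K, [/\ submodule K, W `<=` K, ~ K x &
    forall y, ~ K y -> exists w a, K w /\ x = w + a *: y].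
Proof.
move=> Wsub nWx; have [W0 WD WZ] := Wsub.
(* Adjoining W inside the predicate lets the empty chain, whose union is empty, satisfy it as
   well. *)
pose P K := submodule (W `|` K) /\ ~ (W `|` K) x.
have [F FP Ftot|K [[Ksub nKx] Kmax]] := @Zorn_bigcup _ P.
  have Fcl X : F X -> submodule (W `|` X) by move/FP=> [].
  split; last first.
    by move=> [//|[X FX Xx]]; have [_] := FP _ FX; apply; right.
  split; first by left.
  - move=> u v [Wu|[X FX Xu]] [Wv|[Y FY Yv]].
    + by left; apply: WD.
    + have [_ YD _] := Fcl _ FY.
      have [] := YD u v (or_introl Wu) (or_intror Yv); first by left.
      by right; exists Y.
    + have [_ XD _] := Fcl _ FX.
      have [] := XD u v (or_intror Xu) (or_introl Wv); first by left.
      by right; exists X.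
    + have [/(_ _ Xu) Yu|/(_ _ Yv) Xv] := Ftot _ _ FX FY.
        have [_ YD _] := Fcl _ FY.
        have [] := YD u v (or_intror Yu) (or_intror Yv); first by left.
        by right; exists Y.
      have [_ XD _] := Fcl _ FX.
      have [] := XD u v (or_intror Xu) (or_intror Xv); first by left.
      by right; exists X.
  - move=> a u [Wu|[X FX Xu]]; first by left; apply: WZ.
    have [_ _ XZ] := Fcl _ FX.
    have [] := XZ a u (or_intror Xu); first by left.
    by right; exists X.
exists (W `|` K); split=> // y nKy.
have [K0 _ _] := Ksub.
set L := [set w + a *: y | w in W `|` K & a in [set: A]].
have KL : (W `|` K) `<=` L.
  by move=> w Kw; exists w => //; exists 0 => //; rewrite scale0r addr0.
have Ly : L y by exists 0 => //; exists 1 => //; rewrite scale1r add0r.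
have WL : W `|` L = L by apply/setUidPr => w Ww; apply: KL; left.
have [[w Kw [a _ wax]]|nLx] := pselect (L x); first by exists w, a.
exfalso; apply: (Kmax L); last first.
  by rewrite /P WL; split=> //; apply: submoduleD_line.
split=> [v Kv|/(_ _ Ly) Ky]; first by apply: KL; right.
by apply: nKy; right.
Qed.

End Submodules.

(** * Finite generation and the noetherian property along linear maps *)

Section Transfer.
Variables (A : pzRingType) (V U : lmodType A).

Lemma linear_image_span (f : {linear V -> U}) s :
  f @` span s = span [seq f x | x <- s].
Proof.
apply/seteqP; split=> [_ [v sv <-]|].
  apply: (span_min (W := [set v | span [seq f x | x <- s] (f v)])) sv.
    have [S0 SD SZ] := span_submodule [seq f x | x <- s].
    split=> [|x y Sx Sy|a x Sx] /=; rewrite ?linear0 ?linearD ?linearZ //.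
      exact: SD.
    exact: SZ.
  by move=> x sx; exact: mem_span (map_f f sx).
apply: span_min => [|_ /mapP[x sx ->]]; last by exists x => //; exact: mem_span.
have [S0 SD SZ] := span_submodule s.
split; first by exists 0; rewrite ?linear0.
  move=> _ _ [x sx <-] [y sy <-].
  by exists (x + y); rewrite ?linearD//; apply: SD.
by move=> a _ [x sx <-]; exists (a *: x); rewrite ?linearZ//; apply: SZ.
Qed.

Lemma submodule_image (f : {linear V -> U}) (K : set V) :
  submodule K -> submodule (f @` K).
Proof.
move=> [K0 KD KZ]; split; first by exists 0; rewrite ?linear0.
  move=> _ _ [x Kx <-] [y Ky <-].
  by exists (x + y); rewrite ?linearD//; apply: KD.
by move=> a _ [x Kx <-]; exists (a *: x); rewrite ?linearZ//; apply: KZ.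
Qed.

Lemma submodule_preimage (f : {linear V -> U}) (W : set U) :
  submodule W -> submodule (f @^-1` W).
Proof.
move=> [W0 WD WZ]; split; first by rewrite /preimage /= linear0.
  by move=> x y Wx Wy; rewrite /preimage /= linearD; apply: WD.
by move=> a x Wx; rewrite /preimage /= linearZ; apply: WZ.
Qed.

Lemma submodule_ker (f : {linear V -> U}) : submodule [set x | f x = 0].
Proof.
split=> [|x y /= fx fy|a x /= fx]; first exact: linear0.
  by rewrite linearD fx fy addr0.
by rewrite linearZ /= fx scaler0.
Qed.

(** Lifts to K of generators of the image, together with generators of the part of K killed by f,
    generate K. *)
Lemma fg_set_extension (f : {linear V -> U}) (K : set V) : submodule K ->
  fg_set (f @` K) -> fg_set (K `&` [set x | f x = 0]) -> fg_set K.
Proof.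
move=> Ksub [t ft] [s ks].
have [t' [Kt' def_t]] : exists t',
    (forall x, x \in t' -> K x) /\ t = [seq f x | x <- t'].
  have : forall y, y \in t -> (f @` K) y.
    by move=> y; rewrite ft; exact: mem_span.
  elim: t {ft} => [|y t IHt] Kt; first by exists [::].
  have [z|t' [Kt' ->]] := IHt.
    by move=> tz; apply: Kt; rewrite inE tz orbT.
  have [|x Kx <-] := Kt y; first exact: mem_head.
  exists (x :: t'); split=> // z; rewrite inE => /predU1P[-> //|]; exact: Kt'.
exists (s ++ t'); apply/seteqP; split; last first.
  apply: span_min => // x; rewrite mem_cat => /orP[sx|]; last exact: Kt'.
  by have : span s x by [exact: mem_span]; rewrite -ks => -[].
move=> x Kx; have [y t'y fyx] : (f @` span t') (f x).
  by rewrite linear_image_span -def_t -ft; exists x.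
have Ky : K y by apply: span_min t'y.
have /(span_sub (t := s ++ t')) : span s (x - y).
  by rewrite -ks; split; [exact: submoduleB|rewrite /= linearB fyx subrr].
have [_ SD _] := span_submodule (s ++ t').
rewrite -[x in _ -> span _ x](subrK y) => sxy; apply: SD.
  by apply: sxy => z; rewrite mem_cat => ->.
by apply: span_sub t'y => z; rewrite mem_cat orbC => ->.
Qed.

Lemma fg_set0 (K : set V) : submodule K -> (forall x, K x -> x = 0) -> fg_set K.
Proof.
move=> Ksub K0; exists [::]; apply/seteqP; split=> [x /K0->|x].
  by have [] := span_submodule ([::] : seq V).
exact: span_min.
Qed.

(** The maps [f i] embed V in the n-th power of U. The coordinates are treated one at a time: K is
    an extension of its image under [f i] by its intersection with the kernel of [f i], on which the
    remaining coordinates still separate points from 0. *)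
Lemma noetherian_embedding n (f : 'I_n -> {linear V -> U}) :
  noetherian_module U -> (forall x, (forall i, f i x = 0) -> x = 0) ->
  noetherian_module V.
Proof.
move=> noethU f_inj.
suff H (s : seq 'I_n) (K : set V) : submodule K ->
    (forall x, K x -> (forall i, i \in s -> f i x = 0) -> x = 0) -> fg_set K.
  move=> K Ksub; apply: (H (enum 'I_n)) => // x _ fx; apply: f_inj => i.
  by apply: fx; rewrite mem_enum.
elim: s K => [|i s IHs] K Ksub sK.
  by apply: fg_set0 => // x /sK; apply.
apply: (fg_set_extension (f := f i)) => //.
  exact/noethU/submodule_image.
apply: IHs => [|x [Kx fx] sx]; first exact/submoduleI/submodule_ker.
by apply: sK => // j; rewrite inE => /predU1P[-> //|]; apply: sx.
Qed.

Lemma noetherian_image (f : {linear V -> U}) :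
  noetherian_module V -> (forall y, exists x, f x = y) -> noetherian_module U.
Proof.
move=> noethV f_surj W Wsub.
have [s Ws] := noethV _ (submodule_preimage f Wsub).
exists [seq f x | x <- s]; rewrite -linear_image_span -Ws.
apply/seteqP; split=> [y Wy|_ [x Wx <-] //].
by have [x fx] := f_surj y; exists x; rewrite /preimage /= fx.
Qed.

End Transfer.

Lemma noetherian_finitely_generated (A : pzRingType) (V : lmodType A) :
  noetherian_module V -> finitely_generated V.
Proof. by move=> noethV; apply/finitely_generatedP/noethV. Qed.

(** V is a quotient of the n-th power of X, which is noetherian by its coordinate maps. *)
Lemma noetherian_generated (A : pzRingType) (X V : lmodType A) n
    (f : 'I_n -> {linear X -> V}) :
  noetherian_module X ->
  (forall v, exists c : 'I_n -> X, v = \sum_i f i (c i)) ->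
  noetherian_module V.
Proof.
move=> noethX f_gen.
pose Y : lmodType A := {ffun 'I_n -> X}.
have ev_linear i : linear (fun c : Y => c i) by move=> a c d; rewrite !ffunE.
pose ev i : {linear Y -> X} :=
  HB.pack (fun c : Y => c i) (GRing.isLinear.Build _ _ _ _ _ (ev_linear i)).
have sum_linear : linear (fun c : Y => \sum_i f i (c i)).
  move=> a c d; rewrite scaler_sumr -big_split; apply: eq_bigr => i _.
  by rewrite !ffunE linearP.
pose sum : {linear Y -> V} := HB.pack (fun c : Y => \sum_i f i (c i))
  (GRing.isLinear.Build _ _ _ _ _ sum_linear).
apply: (noetherian_image (f := sum)).
  apply: (noetherian_embedding (f := ev)) => // c c0.
  by apply/ffunP => i; rewrite ffunE; apply: c0.
move=> v; have [c ->] := f_gen v; exists (finfun c).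
by apply: eq_bigr => i _; rewrite ffunE.
Qed.

Lemma fg_noetherian (A : pzRingType) (V : lmodType A) :
  noetherian_module (A^o : lmodType A) -> finitely_generated V ->
  noetherian_module V.
Proof.
move=> noethA [n [e ge]].
have f_linear i : linear (fun a : A^o => (a : A) *: e i).
  by move=> a b c; rewrite scalerDl scalerA.
pose f i : {linear A^o -> V} := HB.pack (fun a : A^o => (a : A) *: e i)
  (GRing.isLinear.Build _ _ _ _ _ (f_linear i)).
exact: (noetherian_generated (f := f)).
Qed.

(** * Artinian commutative rings are noetherian *)

(** Without a minimal member, choosing a strictly smaller one again and again would give a
    descending chain that never stabilises. *)
Lemma artinian_minimal (A : pzRingType) (Q : set (set A)) (I0 : set A) :
  artinian A -> left_ideal I0 -> Q I0 ->
  exists I, [/\ left_ideal I, Q I &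
    forall J, left_ideal J -> Q J -> J `<=` I -> J = I].
Proof.
move=> artA lI0 QI0; apply: contrapT => noMin.
pose T := {I : set A | left_ideal I /\ Q I}.
have smaller (t : T) : exists u : T, sval u `<=` sval t /\ sval u <> sval t.
  case: t => I [lI QI] /=; apply: contrapT => noSmaller; apply: noMin.
  exists I; split=> // J lJ QJ JI; apply: contrapT => neqJI.
  by apply: noSmaller; exists (exist _ J (conj lJ QJ)).
have [f f_smaller] := choice smaller.
pose t0 : T := exist _ I0 (conj lI0 QI0).
have [n|n|N stable] := artA (fun n => sval (iter n f t0)).
- by case: (svalP (iter n f t0)).
- by case: (f_smaller (iter n f t0)).
- have [_ /=] := f_smaller (iter N f t0); apply.
  exact: (stable N.+1 (leqnSn N)).
Qed.

(* Akizuki: for a minimal non-finitely-generated ideal K, multiplication by a  *)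
(* scalar is zero or onto on K, so by the descending chain condition it is     *)
(* invertible as soon as it is nonzero. Hence K is a vector space over a       *)
(* field, and a maximal subspace avoiding a given vector, being proper, is     *)
(* finitely generated and of codimension one.                                  *)
Lemma artinian_noetherian (R : comPzRingType) :
  artinian R -> noetherian_module (R^o : lmodType R).
Proof.
move=> artR K0 K0sub; apply: contrapT => K0nfg.
have [K [Ksub Knfg Kmin]] :=
  artinian_minimal (Q := fun K => ~ fg_set (K : set R^o)) artR K0sub K0nfg.
have Kfg (J : set R^o) : submodule J -> J `<=` K -> J <> K -> fg_set J.
  by move=> Jsub JK neqJK; apply: contrapT => nfgJ; apply/neqJK/Kmin.
(* If both the image a K and the kernel of a on K were proper in K, both would be finitely generated
   by minimality, and then so would K. *)
have mulK a : (forall k, K k -> a * k = 0) \/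
    (forall k, K k -> exists2 l, K l & a * l = k).
  have fL : linear (fun x : R^o => a *: x).
    by move=> b x y; rewrite scalerDr !scalerA mulrC.
  pose f : {linear R^o -> R^o} :=
    HB.pack (fun x : R^o => a *: x) (GRing.isLinear.Build _ _ _ _ _ fL).
  have [fK|nfK] := pselect (f @` K = K).
    by right=> k; rewrite -[X in X k]fK => -[l Kl <-]; exists l.
  have [kerK|nkerK] := pselect (K `&` [set x | f x = 0] = K).
    by left=> k; rewrite -[X in X k]kerK => -[].
  case: Knfg; apply: (fg_set_extension (f := f)) => //; apply: Kfg => //.
  exact: submodule_image.
  by move=> _ [k Kk <-]; have [_ _] := Ksub; apply.
  exact/submoduleI/submodule_ker.
have invK a : (forall k, K k -> a * k = 0) \/
    (exists b, forall k, K k -> b * (a * k) = k).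
  have [|aK] := mulK a; [by left|right].
  have aXK n k : K k -> exists2 l, K l & a ^+ n * l = k.
    elim: n k => [|n IHn] k Kk; first by exists k; rewrite ?mul1r.
    have [l Kl <-] := IHn k Kk; have [m Km <-] := aK l Kl.
    by exists m; rewrite // exprSr mulrA.
  (* The chain of ideals a^n R stabilises, so a^N = a^(N+1) r for some r. As K = a^N K, this r
     inverts a on K. *)
  have [n|n _ [r _ <-]|N stable] :=
    artR (fun n => [set a ^+ n * r | r in [set: R]]).
  - split=> [|_ _ [r _ <-] [t _ <-]|b _ [r _ <-]].
    + by exists 0; rewrite ?mulr0.
    + by exists (r + t); rewrite ?mulrDr.
    + by exists (b * r); rewrite // mulrCA.
  - by exists (a * r); rewrite // mulrA exprSr.
  have : [set a ^+ N * r | r in [set: R]] (a ^+ N) by exists 1; rewrite ?mulr1.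
  rewrite -(stable N.+1 (leqnSn N)) => -[r _ aN]; exists r => k Kk.
  have [l _ <-] := aXK N k Kk.
  rewrite -[in RHS]aN exprSr -!mulrA.
  by rewrite [LHS]mulrCA [r * (_ * _)]mulrCA [LHS]mulrCA.
have [x Kx x0] : exists2 x, K x & x <> 0.
  apply: contrapT => noX; apply/Knfg/fg_set0 => // x Kx.
  by apply: contrapT => x0; apply: noX; exists x.
have zero_sub : submodule [set x : R^o | x = 0].
  by split=> // [_ _ -> ->|a _ ->] /=; rewrite ?addr0 ?scaler0.
have [W [Wsub _ nWx Wmax]] := exists_submodule_avoiding zero_sub x0.
have [s Ws] : fg_set (W `&` K).
  apply: Kfg; [exact: submoduleI|by move=> y []|].
  by move=> WK; apply: nWx; have [] : (W `&` K) x by rewrite WK.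
apply: Knfg; exists (x :: s).
have [_ SD SZ] := span_submodule (x :: s : seq R^o).
have WS w : W w -> K w -> span (x :: s : seq R^o) w.
  move=> Ww Kw; have : span s w by rewrite -Ws.
  by apply: span_sub => z; rewrite inE orbC => ->.
apply/seteqP; split=> [y Ky|]; last first.
  apply: span_min => // y; rewrite inE => /predU1P[-> //|sy].
  by have [] : (W `&` K) y by [rewrite Ws; exact: mem_span].
have [Wy|nWy] := pselect (W y); first exact: WS.
have [w [a [Ww xwa]]] := Wmax y nWy.
(* The scalar a cannot kill K, since then x = w would lie in W. So a has an inverse b on K and y = b
   x - b w, which puts y in the span of x and the intersection of W with K. *)
have [ay0|[b bK]] := invK a.
  by case: nWx; rewrite xwa [a *: y]ay0 ?addr0.
have -> : y = b *: x + (- b) *: w.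
  by rewrite xwa scalerDr scaleNr addrAC addrN add0r -[LHS]bK.
have Kw : K w.
  have -> : w = x - a *: y by rewrite xwa addrK.
  by apply: submoduleB => //; have [_ _] := Ksub; apply.
apply: SD; apply: SZ; last exact: WS.
exact: mem_span (mem_head x s).
Qed.

(** * Finitely generated modules over artin algebras *)

Lemma endo_mulE (R : comPzRingType) (A : pzAlgType R) (V : lmodType A)
    (f g : endo V) x : (f * g) x = f (g x).
Proof. by []. Qed.

Lemma endo_subE (R : comPzRingType) (A : pzAlgType R) (V : lmodType A)
    (f g : endo V) x : (f - g) x = f x - g x.
Proof. by []. Qed.

Section ArtinAlgebras.
Variables (R : comPzRingType) (A : pzAlgType R) (V : lmodType A).
Hypotheses (artA : artin_algebra A) (fgV : finitely_generated V).

(** A is finitely generated over the noetherian ring R, and V is a quotient of a finite power of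
    A. *)
Lemma artin_noetherian_restricted : noetherian_module (restricted V).
Proof.
have [artR fgA] := artA; have [n [e ge]] := fgV.
have noethA := fg_noetherian (artinian_noetherian artR) fgA.
have f_linear i :
    linear (fun a : restricted A^o => (a : A) *: e i : restricted V).
  by move=> r b c; rewrite scalerDl -[(r *: b : A)]/(algmap r * b) -scalerA.
pose f i : {linear restricted A^o -> restricted V} :=
  HB.pack (fun a : restricted A^o => (a : A) *: e i : restricted V)
    (GRing.isLinear.Build _ _ _ _ _ (f_linear i)).
exact: (noetherian_generated (f := f)).
Qed.

(** An endomorphism is determined by its values on n generators, so the endomorphism algebra embeds
    R-linearly in the n-th power of V, which is noetherian over R. *)
Lemma artin_algebra_endo : artin_algebra (endo V).
Proof.
split; first by case: artA.
have [n [e ge]] := fgV.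
pose E : lmodType R := restricted (endo V)^o.
have ev_linear i : linear (fun h : E => (h : endo V) (e i) : restricted V).
  by [].
pose ev i : {linear E -> restricted V} :=
  HB.pack (fun h : E => (h : endo V) (e i) : restricted V)
    (GRing.isLinear.Build _ _ _ _ _ (ev_linear i)).
apply: noetherian_finitely_generated.
apply: (noetherian_embedding (f := ev)) => [|h h0].
  exact: artin_noetherian_restricted.
apply: (@homsP _ _ _ _ (h : endo V) 0) => v.
have [c ->] := ge v; rewrite linear_sum big1// => i _.
by rewrite linearZ /= [(h : endo V) _]h0 scaler0.
Qed.

(* The kernels of the powers of u form an ascending chain, which stabilises    *)
(* because V is noetherian over R.                                             *)
Lemma surjective_endo_left_invertible (u : endo V) :
  (forall y, exists x, u x = y) -> exists z : endo V, z * u = 1.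
Proof.
move=> u_surj.
have uX_surj n y : exists x, (u ^+ n) x = y.
  elim: n y => [|n IHn] y; first by exists y.
  have [x <-] := u_surj y; have [w <-] := IHn x.
  by exists w; rewrite exprS.
have kerS n m x : (u ^+ n) x = 0 -> (u ^+ (m + n)) x = 0.
  by move=> ux; rewrite exprD endo_mulE ux linear0.
pose W : set (restricted V) := [set v | exists n, (u ^+ n) (v : V) = 0].
have Wsub : submodule W.
  split=> [|x y [n xn] [m ym]|r x [n xn]]; first by exists 0; rewrite linear0.
    by exists (m + n)%N; rewrite linearD kerS // addnC kerS // addr0.
  exists n.
  by rewrite -[r *: x]/((algmap r : A) *: (x : V)) linearZ /= xn scaler0.
have [s Ws] := artin_noetherian_restricted Wsub.
have [N sN] : exists N, forall x : V, x \in s -> (u ^+ N) x = 0.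
  have : forall x, x \in s -> W x by move=> x sx; rewrite Ws; exact: mem_span.
  elim: s {Ws} => [|x s IHs] sW; first by exists 0%N.
  have [|N sN] := IHs; first by move=> y sy; apply: sW; rewrite inE sy orbT.
  have [n xn] := sW x (mem_head x s); exists (n + N)%N => y.
  by rewrite inE => /predU1P[->|sy]; [rewrite addnC|]; apply: kerS; auto.
have WN (v : V) : W v -> (u ^+ N) v = 0.
  pose ker : set (restricted V) := [set v | (u ^+ N) (v : V) = 0].
  rewrite Ws; apply: (span_min (W := ker)) => //.
  rewrite /ker; split=> /= [|x y xN yN|r x xN]; first exact: linear0.
    by rewrite linearD xN yN addr0.
  by rewrite -[r *: x]/((algmap r : A) *: (x : V)) linearZ /= xN scaler0.
(* Write v as u^N w. Then u^(N+1) w = 0, so w lies in the union of the kernels, which is the kernel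
   of u^N, and v = 0. *)
have u_inj v : u v = 0 -> v = 0.
  have [w <-] := uX_surj N v => uw; apply: WN; exists N.+1.
  by rewrite exprS.
have [z uz] := choice u_surj.
have zL : linear z.
  move=> a x y; apply/eqP; rewrite -subr_eq0; apply/eqP/u_inj.
  by rewrite linearB linearP /= !uz subrr.
exists (mk_hom zL); apply: homsP => x.
by apply/eqP; rewrite -subr_eq0; apply/eqP/u_inj; rewrite linearB /= uz subrr.
Qed.

End ArtinAlgebras.

(** * The Jacobson radical and Nakayama's lemma *)

(** If a maximal left ideal K missed x, then 1 = k + y x with k in K, and the left invertible
    element k = 1 - y x would force K to be everything. *)
Lemma mem_jacobson_radical (A : pzRingType) (x : A) :
  (forall y, exists z, z * (1 - y * x) = 1) -> jacobson_radical A x.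
Proof.
move=> xinv K [lK KT Kmax]; apply: contrapT => nKx.
have Ksub : submodule (K : set A^o) by [].
have [K0 KD KM] := lK.
have [|JK|JT] := Kmax _ (submoduleD_line (x : A^o) Ksub).
- by move=> k Kk; exists k => //; exists 0; rewrite ?scale0r ?addr0.
- by apply: nKx; rewrite -JK; exists 0 => //; exists 1; rewrite ?scale1r ?add0r.
- have : [set: A] 1 by []; rewrite -JT => -[k Kk [y _ kyx]].
  have [z zk] := xinv y; apply: KT; apply/seteqP; split=> // a _.
  rewrite -[a]mulr1 -zk -[X in X - _]kyx addrK mulrA; exact: KM.
Qed.

(** The last hypothesis expresses W + I V = V without forming the sum. Generators are discarded one
    at a time: if e were not redundant, a submodule K maximal among those containing U and avoiding
    e would contain both W and I V, a contradiction. *)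
Lemma nakayama (A : pzRingType) (V : lmodType A) (I : set A) (W : set V) :
  two_sided_ideal I -> I `<=` jacobson_radical A -> finitely_generated V ->
  submodule W ->
  (forall U, submodule U -> W `<=` U -> (forall a v, I a -> U (a *: v)) ->
    U = setT) ->
  W = setT.
Proof.
move=> [_ IM] Irad /finitely_generatedP[s sT] Wsub WI.
have : forall U, submodule U -> W `<=` U -> (forall x, x \in s -> U x) ->
    U = setT.
  move=> U Usub _ sU; apply/seteqP; split=> // v.
  by rewrite sT; apply: span_min.
elim: s {sT} => [|e s IHs] sW; first exact: sW.
apply: IHs => U Usub WU sU.
have [Ue|nUe] := pselect (U e).
  by apply: sW => // x; rewrite inE => /predU1P[->//|]; apply: sU.
have [K [Ksub UK nKe Kmax]] := exists_submodule_avoiding Usub nUe.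
have [K0 KD KZ] := Ksub.
suff KT : K = setT by case: nKe; rewrite KT.
apply: WI => [//|w /WU /UK //|a v Ia].
(* S is the annihilator of the class of e modulo K. It is a maximal left ideal: for b outside S,
   maximality of K gives e = w + c b e with w in K, so 1 - c b lies in S. Hence I, being in the
   radical, lies in S. *)
pose S : set A := [set b | K (b *: e)].
have Smax : maximal_left_ideal S.
  split.
  - split=> [|x y|b x]; rewrite /S /= ?scale0r ?scalerDl -?scalerA //.
      exact: KD.
    exact: KZ.
  - by move=> ST; apply: nKe; have : S 1 by [rewrite ST]; rewrite /S /= scale1r.
  - move=> J [J0 JD JM] SJ; have [JS|] := pselect (J `<=` S).
      by left; apply/seteqP.
    move=> /existsNP[b /not_implyP[Jb nSb]]; right.
    have [w [c [Kw ewc]]] := Kmax _ nSb.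
    have J1 : J 1.
      rewrite -[1](subrK (c * b)); apply: JD; last exact: JM.
      apply: SJ; rewrite /S /= scalerBl scale1r -scalerA.
      by rewrite [X in K (X - _)]ewc addrK.
    by apply/seteqP; split=> // x _; rewrite -[x]mulr1; apply: JM.
(* K + A e contains W and all the generators, so it is V. For v = w + r e, the element a r stays in
   I because I is two-sided, so a v lies in K. *)
have LT := sW _ (submoduleD_line e Ksub).
have [w Kw [r _ <-]] : [set w + a *: e | w in K & a in [set: A]] v.
  rewrite LT // => [w /WU/UK Kw|x].
    by exists w => //; exists 0; rewrite ?scale0r ?addr0.
  rewrite inE => /predU1P[->|/sU/UK Kx].
    by exists 0 => //; exists 1; rewrite ?scale1r ?add0r.
  by exists x => //; exists 0; rewrite ?scale0r ?addr0.
rewrite scalerDr scalerA; apply: KD; first exact: KZ.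
exact: (Irad _ (IM _ r Ia) S Smax).
Qed.

(** * The decomposition of the induced module *)

Lemma tensBr (A B : pzRingType) (X : bimodType A B) (M : lmodType B)
    (x : X) (m n : M) : tens x (m - n) = tens x m - tens x n.
Proof. by apply/eqP; rewrite eq_sym subr_eq -tensDr subrK. Qed.

Lemma tens0r (A B : pzRingType) (X : bimodType A B) (M : lmodType B) (x : X) :
  tens x (0 : M) = 0.
Proof. by rewrite -(subrr (0 : M)) tensBr subrr. Qed.

Section InducedModule.
Variables (R : comPzRingType) (Gam Lam : pzAlgType R) (I : twoSidedIdeal Gam).
Variables (pi : pzAlgHom Gam Lam) (sigma : pzAlgHom Lam Gam) (M : lmodType Lam).
Hypothesis (ker_pi : forall g, pi g = 0 <-> (I : set Gam) g).
Hypothesis sigmaK : cancel sigma pi.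

Local Notation GM := (induced_module sigma M).
Local Notation IM := (ideal_tensor sigma I M).
Local Notation tensG g m := (tens (g : ext_bimod sigma) m : GM).

Definition base_proj : GM -> M :=
  tens_lift (fun (g : ext_bimod sigma) (m : M) => pi g *: m).

Fact base_proj_balanced :
  balanced (fun (g : ext_bimod sigma) (m : M) => pi g *: m).
Proof.
split=> [g h m|g m n|g l m]; rewrite ?rmorphD ?scalerDl ?scalerDr //.
by rewrite [pi _]rmorphM /= sigmaK scalerA.
Qed.

Lemma base_projE g m : base_proj (tensG g m) = pi g *: m.
Proof. exact/tens_liftE/base_proj_balanced. Qed.

Fact base_proj_zmod : zmod_morphism base_proj.
Proof. exact/tens_lift_zmod/base_proj_balanced. Qed.
HB.instance Definition _ :=
  GRing.isZmodMorphism.Build GM M base_proj base_proj_zmod.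

Lemma base_proj_scale g t : base_proj (g *: t) = pi g *: base_proj t.
Proof.
move: t; apply: tens_ext => [s t|s t|x m].
- by rewrite scalerBr raddfB.
- by rewrite raddfB scalerBr.
- by rewrite tensZ !base_projE scalerA -rmorphM.
Qed.

Fact ideal_part_subproof g : g - sigma (pi g) \in (I : set Gam).
Proof. by rewrite inE; apply/ker_pi; rewrite rmorphB /= sigmaK subrr. Qed.

Definition ideal_part g : ideal_bimod sigma I :=
  IdealElt (ideal_part_subproof g).

(** This is induced by the projection of Gam onto I along the image of sigma, which respects both
    Lam-actions. *)
Definition ideal_retract : GM -> IM :=
  tens_lift (fun (g : ext_bimod sigma) (m : M) => tens (ideal_part g) m).

Fact ideal_retract_balanced :
  balanced (fun (g : ext_bimod sigma) (m : M) => tens (ideal_part g) m : IM).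
Proof.
split=> [g h m|g m n|g l m]; last 1 first.
- rewrite -tensA; congr tens; apply: val_inj => /=.
  by rewrite [pi _]rmorphM /= sigmaK rmorphM mulrBl.
- rewrite -tensDl; congr tens; apply: val_inj => /=.
  by rewrite !rmorphD opprD addrACA.
- exact: tensDr.
Qed.

Lemma ideal_retractE g m : ideal_retract (tensG g m) = tens (ideal_part g) m.
Proof. exact/tens_liftE/ideal_retract_balanced. Qed.

Fact ideal_retract_zmod : zmod_morphism ideal_retract.
Proof. exact/tens_lift_zmod/ideal_retract_balanced. Qed.
HB.instance Definition _ :=
  GRing.isZmodMorphism.Build GM IM ideal_retract ideal_retract_zmod.

Lemma ideal_retract_scale l t :
  ideal_retract (sigma l *: t) = l *: ideal_retract t.
Proof.
move: t; apply: tens_ext => [s t|s t|x m].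
- by rewrite scalerBr raddfB.
- by rewrite raddfB scalerBr.
- rewrite !tensZ !ideal_retractE tensZ; congr tens; apply: val_inj => /=.
  by rewrite [pi _]rmorphM /= sigmaK rmorphM mulrBr.
Qed.

Lemma ideal_inclK : cancel (@ideal_incl _ _ _ sigma I M) ideal_retract.
Proof.
apply: tens_ext => [s t|//|x m]; first by rewrite !raddfB.
rewrite ideal_inclE ideal_retractE; congr tens; apply: val_inj => /=.
have /ker_pi-> : (I : set Gam) (ideal_val x).
  by have := ideal_valP x; rewrite inE.
by rewrite raddf0 subr0.
Qed.

Lemma induced_decomposition (t : GM) :
  t = ideal_incl (ideal_retract t) + tensG 1 (base_proj t).
Proof.
move: t; apply: tens_ext => [//|s t|g m].
  by rewrite !raddfB /= tensBr opprD addrACA.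
rewrite ideal_retractE ideal_inclE base_projE -tensA -tensDl; congr tens.
by rewrite /= [ract _ _]mul1r subrK.
Qed.

Lemma tensG1_scale l m : tensG 1 (l *: m) = sigma l *: tensG 1 m.
Proof. by rewrite -tensA tensZ; congr tens; rewrite [LHS]mul1r [RHS]mulr1. Qed.

Lemma tensG_scale1 (g : ext_bimod sigma) m : tens g m = (g : Gam) *: tensG 1 m.
Proof. by rewrite tensZ; congr tens; rewrite [RHS]mulr1. Qed.

Lemma tensG1_linear (N : lmodType Gam) (f : {linear GM -> N}) l m n :
  f (tensG 1 (l *: m + n)) = sigma l *: f (tensG 1 m) + f (tensG 1 n).
Proof. by rewrite tensDr tensG1_scale linearD linearZ. Qed.

(** The elements 1 (x) m generate G(M) over Gam; this is the uniqueness half of the tensor-hom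
    adjunction. *)
Lemma induced_ext (N : lmodType Gam) (f g : homs GM N) :
  (forall m, f (tensG 1 m) = g (tensG 1 m)) -> f = g.
Proof.
move=> fg; apply: homsP; apply: tens_ext => [s t|s t|x m]; rewrite ?linearB //.
by rewrite tensG_scale1 !linearZ /= fg.
Qed.

(** * The projection onto the endomorphisms of M and its section *)

Fact endo_proj_linear (f : endo GM) :
  linear (fun m => base_proj (f (tensG 1 m))).
Proof.
by move=> l m n; rewrite tensG1_linear raddfD /= base_proj_scale sigmaK.
Qed.

Definition endo_proj (f : endo GM) : endo M := mk_hom (endo_proj_linear f).

Lemma endo_projE f m : endo_proj f m = base_proj (f (tensG 1 m)).
Proof. by []. Qed.

(** Every f preserves the kernel of [base_proj] and so acts on the quotient M of G(M); that action
    is [endo_proj f]. This is what makes [endo_proj] multiplicative. *)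
Lemma base_proj_endo (f : endo GM) t :
  base_proj (f t) = endo_proj f (base_proj t).
Proof.
move: t; apply: tens_ext => [s t|s t|x m].
- by rewrite !raddfB.
- by rewrite !raddfB.
rewrite base_projE tensG_scale1 linearZ /= base_proj_scale.
by rewrite tensG1_scale linearZ /= base_proj_scale sigmaK.
Qed.

Fact endo_proj_zmod : zmod_morphism endo_proj.
Proof. by move=> f g; apply: homsP => m; rewrite /= raddfB. Qed.
Fact endo_proj_monoid : monoid_morphism endo_proj.
Proof.
split=> [|f g]; apply: homsP => m /=.
  by rewrite base_projE rmorph1 scale1r.
exact: base_proj_endo.
Qed.
HB.instance Definition _ :=
  GRing.isZmodMorphism.Build (endo GM) (endo M) endo_proj endo_proj_zmod.
HB.instance Definition _ :=
  GRing.isMonoidMorphism.Build (endo GM) (endo M) endo_proj endo_proj_monoid.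

Fact endo_proj_algmap r : endo_proj (algmap r) = algmap r.
Proof.
apply: homsP => m /=.
by rewrite base_proj_scale alghom_algmap base_projE rmorph1 scale1r.
Qed.
HB.instance Definition _ :=
  isPzAlgHom.Build R (endo GM) (endo M) endo_proj endo_proj_algmap.

Fact endo_induced_balanced (f : endo M) :
  balanced (fun (g : ext_bimod sigma) (m : M) => tensG g (f m)).
Proof.
split=> [g h m|g m n|g l m]; rewrite ?tensDl ?linearD ?tensDr //.
by rewrite linearZ /= tensA.
Qed.

Definition endo_induced_fun (f : endo M) : GM -> GM :=
  tens_lift (fun (g : ext_bimod sigma) (m : M) => tensG g (f m)).

Lemma endo_induced_funE f g m : endo_induced_fun f (tensG g m) = tensG g (f m).
Proof. exact/tens_liftE/endo_induced_balanced. Qed.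

Fact endo_induced_fun_zmod f : zmod_morphism (endo_induced_fun f).
Proof. exact/tens_lift_zmod/endo_induced_balanced. Qed.
HB.instance Definition _ f :=
  GRing.isZmodMorphism.Build GM GM (endo_induced_fun f)
    (endo_induced_fun_zmod f).

Fact endo_induced_linear f : linear (endo_induced_fun f).
Proof.
move=> a u v; rewrite raddfD /=; congr (_ + _).
move: u; apply: tens_ext => [s t|s t|x m].
- by rewrite scalerBr raddfB.
- by rewrite raddfB scalerBr.
- by rewrite tensZ !endo_induced_funE tensZ.
Qed.

Definition endo_induced (f : endo M) : endo GM :=
  mk_hom (endo_induced_linear f).

Lemma endo_inducedE f g m : endo_induced f (tensG g m) = tensG g (f m).
Proof. exact: endo_induced_funE. Qed.

Fact endo_induced_zmod : zmod_morphism endo_induced.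
Proof.
move=> f g; apply: induced_ext => m.
by rewrite endo_subE !endo_inducedE endo_subE tensBr.
Qed.
Fact endo_induced_monoid : monoid_morphism endo_induced.
Proof.
split=> [|f g]; apply: induced_ext => m; first by rewrite endo_inducedE.
by rewrite endo_mulE !endo_inducedE.
Qed.
HB.instance Definition _ :=
  GRing.isZmodMorphism.Build (endo M) (endo GM) endo_induced endo_induced_zmod.
HB.instance Definition _ :=
  GRing.isMonoidMorphism.Build (endo M) (endo GM) endo_induced
    endo_induced_monoid.

Fact endo_induced_algmap r : endo_induced (algmap r) = algmap r.
Proof.
apply: induced_ext => m; rewrite endo_inducedE /= tensG1_scale.
by rewrite alghom_algmap.
Qed.
HB.instance Definition _ :=
  isPzAlgHom.Build R (endo M) (endo GM) endo_induced endo_induced_algmap.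

Lemma endo_inducedK : cancel endo_induced endo_proj.
Proof.
move=> f; apply: homsP => m /=.
by rewrite endo_induced_funE base_projE rmorph1 scale1r.
Qed.

(** * The range of L: kernel, ideal, radical *)

Lemma hom_embedding1 (h : homs M IM) m :
  hom_embedding sigma I M h (tensG 1 m) = ideal_incl (h m).
Proof. by rewrite hom_embeddingE scale1r. Qed.

Lemma hom_embedding_injective : injective (hom_embedding sigma I M).
Proof.
move=> h k hk; apply: homsP => m; apply: (can_inj ideal_inclK).
by rewrite -!hom_embedding1 hk.
Qed.

Lemma base_proj_incl (t : IM) : base_proj (ideal_incl t) = 0.
Proof.
have := induced_decomposition (ideal_incl t); rewrite ideal_inclK.
move=> /(congr1 base_proj); rewrite raddfD /= base_projE rmorph1 scale1r.
by move=> /eqP; rewrite -[X in X == _]addr0 (inj_eq (addrI _)) => /eqP.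
Qed.

(** When the projection of f vanishes, f(1 (x) m) has no component in 1 (x) M, so it is recovered
    from its component in I (x) M; sending m to that component is the required preimage under L. *)
Lemma endo_proj_eq0 (f : endo GM) :
  endo_proj f = 0 <-> range (hom_embedding sigma I M) f.
Proof.
split=> [f0|[h _ <-]]; last first.
  by apply: homsP => m; rewrite endo_projE hom_embedding1 base_proj_incl.
have hL : linear (fun m => ideal_retract (f (tensG 1 m))).
  by move=> l m n; rewrite tensG1_linear raddfD /= ideal_retract_scale.
exists (mk_hom hL) => //; apply: induced_ext => m.
rewrite hom_embedding1 [RHS]induced_decomposition base_proj_endo f0 /=.
by rewrite tens0r addr0.
Qed.

Lemma finitely_generated_induced :
  finitely_generated M -> finitely_generated GM.
Proof.
move=> [n [e ge]]; apply/finitely_generatedP.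
exists (codom (fun i => tensG 1 (e i))); apply/seteqP; split=> // t _.
have [S0 SD SZ] := span_submodule (codom (fun i => tensG 1 (e i))).
elim/tens_ind: t => [//|s t Ss St|x m].
  exact: (submoduleB (span_submodule _)).
rewrite tensG_scale1.
apply: (SZ); have [c ->] := ge m.
elim/big_rec: _ => [|i y _ Sy]; first by rewrite tens0r.
rewrite tensDr tensG1_scale; apply: SD => //; apply: SZ.
exact: (mem_span (codom_f (fun i => tensG 1 (e i)) i)).
Qed.

Lemma ideal_incl_mem (U : set GM) : submodule U ->
  (forall a v, (I : set Gam) a -> U (a *: v)) ->
  forall t : IM, U (ideal_incl t).
Proof.
move=> Usub IU; elim/tens_ind => [|s t Us Ut|x m].
- by rewrite raddf0; case: Usub.
- by rewrite raddfB; apply: submoduleB.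
- rewrite ideal_inclE tensG_scale1.
  by apply: IU; have := ideal_valP x; rewrite inE.
Qed.

(** Each t equals (1 - f) t + f t with f t in I G(M), so the range of 1 - f and I G(M) together
    generate G(M), and Nakayama's lemma applies to that range. *)
Lemma hom_embedding_surjective1B (h : homs M IM) :
  (I : set Gam) `<=` jacobson_radical Gam -> finitely_generated M ->
  forall y, exists x, (1 - hom_embedding sigma I M h) x = y.
Proof.
move=> Irad fgM; set f := hom_embedding sigma I M h.
have : range (1 - f) = setT.
  apply: (nakayama (ideal_two_sided I) Irad (finitely_generated_induced fgM)).
    by apply: (submodule_image (1 - f : homs GM GM)).
  move=> U Usub ranU IU; apply/seteqP; split=> // t _.
  have [_ UD UZ] := Usub.
  rewrite -[t](subrK (f t)); apply: UD; first by apply: ranU; exists t.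
  elim/tens_ind: t => [|s t Us Ut|g m]; first by rewrite linear0; case: Usub.
    by rewrite linearB; apply: submoduleB.
  by rewrite hom_embeddingE; apply: UZ; exact: ideal_incl_mem.
by move=> ranT y; have : setT y by []; rewrite -ranT => -[x _ <-]; exists x.
Qed.

Lemma range_hom_embedding_ideal :
  two_sided_ideal (range (hom_embedding sigma I M)).
Proof.
split; first split.
- by apply/endo_proj_eq0; rewrite raddf0.
- move=> f g /endo_proj_eq0 f0 /endo_proj_eq0 g0; apply/endo_proj_eq0.
  by rewrite raddfD /= f0 g0 addr0.
- move=> f g /endo_proj_eq0 g0; apply/endo_proj_eq0.
  by rewrite rmorphM /= g0 mulr0.
- move=> f g /endo_proj_eq0 f0; apply/endo_proj_eq0.
  by rewrite rmorphM /= f0 mul0r.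
Qed.

End InducedModule.

Theorem theorem4p3 (R : comPzRingType) (Gam Lam : pzAlgType R)
    (I : twoSidedIdeal Gam) (pi : pzAlgHom Gam Lam) (sigma : pzAlgHom Lam Gam)
    (Gam_ext : split_by_nilpotent_data I pi sigma)
    (M : lmodType Lam) (M_fg : finitely_generated M) :
  injective (hom_embedding sigma I M) /\
  split_by_nilpotent_extension (endo (induced_module sigma M)) (endo M)
    (range (hom_embedding sigma I M)).
Proof.
have [[artG artL] _ Irad [_ ker_pi] sigmaK] := Gam_ext.
have GM_fg := finitely_generated_induced sigma M_fg.
split; first exact: hom_embedding_injective ker_pi sigmaK.
have idealL := range_hom_embedding_ideal M ker_pi sigmaK.
exists (endo_proj sigmaK (M := M)), (endo_induced sigma (M := M)); split.
- by split; apply: artin_algebra_endo.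
- exact: idealL.
- move=> f Lf; apply: mem_jacobson_radical => g.
  (* The multiple g f is again of the form L(h), so the claim reduces to the left invertibility of 1
     - L(h). *)
  have [[_ _ IM] _] := idealL; have [h _ <-] := IM g f Lf.
  apply: (surjective_endo_left_invertible artG GM_fg).
  exact: hom_embedding_surjective1B.
- split=> [f|f]; last exact: endo_proj_eq0.
  by exists (endo_induced sigma f); apply: endo_inducedK.
- by move=> f; apply: endo_inducedK.
Qed.
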